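(* Let $(X,d)$ be a compact metric space and let ${\bf m}$ be a Borel probability measure on $X$ such that the metric measure space $(X,d,{\bf m})$ is regular. Let $\mu\in P(X)$ and, for each $\epsilon>0$, let $\mu_\epsilon$ be the unique minimizer over $\nu\in P(X)$ of $$F_\epsilon(\nu)=\int_X\int_X d^2(y,x)\,d\mu(x)\,d\nu(y)+\epsilon\, W_2^2({\bf m},\nu).$$ Then, as $\epsilon\to 0$, the measures $\mu_\epsilon$ converge in the weak-* topology to a unique limit $B(\mu)\in P(X)$, and $$\operatorname{supp}({\bf m})\cap b(\mu)\ \subseteq\ \operatorname{supp} B(\mu)\ \subseteq\ b(\mu).$$ Moreover, $B(\mu)$ is the unique minimizer of the functional $\nu\mapsto W_2(\nu,{\bf m})$ among $\nu\in P(X)$ with $\operatorname{supp}\nu\subset b(\mu)$, i.e. $$\{B(\mu)\}=\operatorname{argmin}\{\,W_2(\nu,{\bf m}) : \nu\in P(X),\ \operatorname{supp}\nu\subset b(\mu)\,\}.$$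
   Context: $P(X)$ is the set of Borel probability measures on $X$ with the weak-* topology. For $\mu,\nu\in P(X)$, $W_2^2(\mu,\nu)=\inf_\gamma\int_{X\times X}d^2(x,y)\,d\gamma(x,y)$, where the infimum is over all Borel probability measures $\gamma$ on $X\times X$ with first marginal $\mu$ and second marginal $\nu$; $W_2\ge 0$ is its square root. For $\mu\in P(X)$, the set of barycentric points of $\mu$ is $b(\mu)=\operatorname{argmin}_{y\in X}\int_X d^2(x,y)\,d\mu(x)$, i.e. the set of all minimizers of this function of $y$. $(X,d,{\bf m})$ is called regular if for every $\nu\in P(X)$, any minimizer $\gamma$ in the definition of $W_2({\bf m},\nu)$ is concentrated on the graph of a function, that is, $\gamma=(\mathrm{Id},T)_\#{\bf m}$ for a map $T:X\to X$. If $(X,d,{\bf m})$ is regular, $F_\epsilon$ has exactly one minimizer on $P(X)$ for each $\epsilon>0$. *)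

(* Defs.v *)
From HB Require Import structures.
From mathcomp Require Import all_boot all_order all_algebra.
From mathcomp Require Import all_classical all_reals all_analysis.

Set Implicit Arguments.
Unset Strict Implicit.
Unset Printing Implicit Defensive.

Import Order.TTheory GRing.Theory Num.Theory.
Import numFieldNormedType.Exports.

Local Open Scope classical_set_scope.
Local Open Scope ring_scope.

(* Measurable types are pointed in MathComp-Analysis.  Pointedness only says
   that the metric space is nonempty, which holds as soon as it carries a
   probability measure. *)
#[short(type="pmetricType")]
HB.structure Definition PointedMetric (R : numDomainType) :=
  { X of Pointed X & Metric R X }.

Notation borel X := (g_sigma_algebraType (@open X)).

Section prob.
Context (R : realType) (X : ptopologicalType).

Definition Prob : Type := probability (borel X) R.

(* A library measure is a function on all subsets, unconstrained outside the
   sigma-algebra: this relation, not Leibniz equality, is the equality of Borel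
   measures, and the topology below separates points of [Prob] only up to it. *)
Definition borel_eq (m1 m2 : set X -> \bar R) : Prop :=
  forall A : set (borel X), measurable A -> m1 A = m2 A.

HB.instance Definition _ := Choice.on Prob.

Definition integral_continuous (mu : Prob) : {ptws continuousType X R -> R} :=
  fun f => \int[mu]_x f x.

(* The weak-* topology induced by the duality with C(X), X being compact *)
HB.instance Definition _ :=
  Topological.copy Prob (initial_topology integral_continuous).

Definition supp (mu : Prob) : set X :=
  [set x | forall U, open_nbhs x U -> (0 < mu U)%E].

Lemma cvg_ProbP (F : set_system Prob) (mu : Prob) : Filter F ->
  F --> mu <-> forall f : continuousType X R,
    (fun nu : Prob => \int[nu]_x f x) @ F --> \int[mu]_x f x.
Proof.
move=> FF; split=> [Fmu f|Fmu].
  have Imu : integral_continuous @ F --> integral_continuous mu.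
    exact: cvg_comp Fmu (@initial_continuous _ _ integral_continuous mu).
  have /cvg_sup/(_ f) Imuf := Imu.
  exact: cvg_comp Imuf (@initial_continuous _ _ (fun g => g f) _).
have Imu : integral_continuous @ F --> integral_continuous mu.
  apply/cvg_sup => f A [_ [[B Bo <-] Bmu sBA]].
  by apply: filterS sBA _; apply: Fmu; exact: open_nbhs_nbhs.
move=> A [_ [[B Bo <-] Bmu sBA]].
by apply: filterS sBA _; apply: Imu; exact: open_nbhs_nbhs.
Qed.

End prob.

Definition argmin (R : realType) (T : Type) (D : set T) (f : T -> \bar R) :
    set T :=
  [set x | D x /\ forall y, D y -> (f x <= f y)%E].

(* Lets the library's pointed and topological structures on products be joined. *)
HB.instance Definition _ (X Y : ptopologicalType) :=
  Pointed.on (X * Y)%type.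

Section wasserstein.
Local Open Scope ereal_scope.
Context (R : realType) (X : pmetricType R).

Definition sqdist (x y : X) : \bar R := ((mdist x y) ^+ 2)%:E.

(* [borel (X * X)] is the Borel sigma-algebra of the product topology. *)
Definition coupling (mu nu : Prob R X) : set (Prob R (X * X)%type) :=
  [set gamma |
    borel_eq (pushforward gamma (fst : borel (X * X)%type -> borel X)) mu /\
    borel_eq (pushforward gamma (snd : borel (X * X)%type -> borel X)) nu].

Definition cost (gamma : Prob R (X * X)%type) : \bar R :=
  \int[gamma]_z sqdist z.1 z.2.

Definition W2sq (mu nu : Prob R X) : \bar R :=
  ereal_inf [set cost gamma | gamma in coupling mu nu].

Definition W2 (mu nu : Prob R X) : \bar R := sqrte (W2sq mu nu).

Definition barycenters (mu : Prob R X) : set X :=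
  argmin [set: X] (fun y => \int[mu]_x sqdist x y).

Definition regular_mms (m : Prob R X) : Prop :=
  forall (nu : Prob R X) (gamma : Prob R (X * X)%type),
    argmin (coupling m nu) cost gamma ->
    exists2 T : borel X -> borel X, measurable_fun [set: borel X] T &
      borel_eq gamma
        (pushforward m (fun x : borel X => (x, T x) : borel (X * X)%type)).

Definition F_eps (m mu : Prob R X) (eps : R) (nu : Prob R X) : \bar R :=
  \int[nu]_y \int[mu]_x sqdist y x + eps%:E * W2sq m nu.

End wasserstein.

(* Main.v *)
(* Let [a y] be the excess of [\int d^2(x, y) dmu(x)] over its minimum and [K] the
   compact zero set of [a], which is [b(mu)]. A coupling of [m] with a measure
   carried by [K] costs at least [\int dist(x, K)^2 dm(x)], and equality holds for
   [(Id, T)_# m] whenever [T] selects measurably from the nearest-point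
   correspondence onto [K]; put [B = T_# m]. Mixing the graphs of two selections
   with weights 1/2 gives an optimal coupling, so regularity makes any two
   selections agree almost everywhere. By compactness, every coupling whose
   second marginal has small mean excess and whose cost is at most slightly
   above [\int dist(x, K)^2 dm(x)] then has second marginal weakly close to [B].
   Comparing [F_eps (mu_eps)] with [F_eps B] shows that [mu_eps] has mean excess
   at most [eps \int dist(x, K)^2 dm(x)] and [W_2^2(m, mu_eps)] at most
   [\int dist(x, K)^2 dm(x)]: this gives the convergence, and the same estimate
   gives uniqueness of the minimizer. *)
Require Import Defs.
From HB Require Import structures.
From mathcomp Require Import all_boot all_order all_algebra.
From mathcomp Require Import all_classical all_reals all_analysis.
From mathcomp Require Import measurable_realfun ring lra.

Set Implicit Arguments.
Unset Strict Implicit.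
Unset Printing Implicit Defensive.

Import Order.TTheory GRing.Theory Num.Theory.
Import numFieldNormedType.Exports.

Local Open Scope classical_set_scope.
Local Open Scope ring_scope.

(** * Continuity of the distance and of the distance to a set *)

Section metric.
Context (R : realType) (X : pmetricType R).
Implicit Types (x y z : X) (K C : set X).

Lemma nbhs_mdist x (A : set X) :
  nbhs x A <-> exists2 e : R, 0 < e & forall y, mdist x y < e -> A y.
Proof.
split=> [/nbhs_ballP[e /= e0 eA]|[e e0 eA]].
  by exists e => // y xy; apply: eA; rewrite ballEmdist.
by apply/nbhs_ballP; exists e => //= y; rewrite ballEmdist; exact: eA.
Qed.

Lemma lipschitz1_continuous (f : X -> R) :
  (forall x y, f x <= mdist x y + f y) -> continuous f.
Proof.
move=> fL x; apply/cvgrPdist_lt => e e0; apply/nbhs_mdist; exists e => // y xy.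
rewrite ltr_norml ltrBlDr ltrBrDl; apply/andP; split.
  by rewrite ltrBlDr (le_lt_trans (fL y x))// addrC metric_sym ltrD2l.
by rewrite (le_lt_trans (fL x y))// ltrD2r.
Qed.

Lemma continuous_mdist : continuous (fun z : X * X => mdist z.1 z.2).
Proof.
case=> x y; apply/cvgrPdist_lt => e e0; have e20 : 0 < e / 2 by rewrite divr_gt0.
have nx : \forall z \near (x, y), mdist x z.1 < e / 2.
  by apply: (@cvg_fst _ _ (nbhs x) (nbhs y) _ [set z | mdist x z < e / 2]);
    apply/nbhs_mdist; exists (e / 2).
have ny : \forall z \near (x, y), mdist y z.2 < e / 2.
  by apply: (@cvg_snd _ _ (nbhs x) (nbhs y) _ [set z | mdist y z < e / 2]);
    apply/nbhs_mdist; exists (e / 2).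
near=> z => /=; have xz : mdist x z.1 < e / 2 by near: z.
have yz : mdist y z.2 < e / 2 by near: z.
have := metric_triangle x z.1 y; have := metric_triangle z.1 z.2 y.
have := metric_triangle z.1 x z.2; have := metric_triangle x y z.2.
rewrite (metric_sym z.2 y) (metric_sym z.1 x) ltr_norml; lra.
Unshelve. all: by end_near. Qed.

Lemma continuous_mdistr x : continuous (mdist x).
Proof.
apply: lipschitz1_continuous => y z; rewrite addrC.
by rewrite (metric_sym y z) (le_trans (metric_triangle x z y)).
Qed.

Definition infdist C x : R := inf [set mdist x y | y in C].

Lemma infdist_has_inf C x : C !=set0 -> has_inf [set mdist x y | y in C].
Proof.
move=> [y Cy]; split; first by exists (mdist x y), y.
by exists 0 => _ [z _ <-]; exact: mdist_ge0.
Qed.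

Lemma infdist_le C x y : C y -> infdist C x <= mdist x y.
Proof.
move=> Cy; apply: ge_inf; last by exists y.
by exists 0 => _ [z _ <-]; exact: mdist_ge0.
Qed.

Lemma infdist_glb C x (r : R) : C !=set0 ->
  (forall y, C y -> r <= mdist x y) -> r <= infdist C x.
Proof.
move=> [y Cy] rC; apply: lb_le_inf; first by exists (mdist x y), y.
by move=> _ [z Cz <-]; exact: rC.
Qed.

Lemma infdist_ge0 C x : C !=set0 -> 0 <= infdist C x.
Proof. by move=> C0; apply: infdist_glb => // y _; exact: mdist_ge0. Qed.

Lemma infdist_triangle C x y : C !=set0 ->
  infdist C x <= mdist x y + infdist C y.
Proof.
move=> C0; rewrite -lerBlDl; apply: infdist_glb => // z Cz.
by rewrite lerBlDl (le_trans (infdist_le x Cz))// metric_triangle.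
Qed.

Lemma continuous_infdist C : C !=set0 -> continuous (infdist C).
Proof.
by move=> C0; apply: lipschitz1_continuous => x y; exact: infdist_triangle.
Qed.

Lemma infdist_eq0 C x : C !=set0 -> closed C -> infdist C x = 0 -> C x.
Proof.
move=> C0 cC Cx; apply: cC => A /nbhs_mdist[e e0 eA].
have [_ [y Cy <-] xy] := inf_adherent e0 (infdist_has_inf x C0).
exists y; split=> //; apply: eA; move: xy.
by rewrite -/(infdist C x) Cx add0r.
Qed.

Lemma infdist_mem C x : C x -> infdist C x = 0.
Proof.
move=> Cx; apply/eqP; rewrite eq_le infdist_ge0; last by exists x.
by rewrite andbT (le_trans (infdist_le x Cx))// mdistxx.
Qed.

Lemma infdist_gt0 C x : C !=set0 -> closed C -> ~ C x -> 0 < infdist C x.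
Proof.
move=> C0 cC nCx; rewrite lt_neqAle infdist_ge0// andbT.
by apply/eqP => /esym Cx; apply: nCx; exact: infdist_eq0.
Qed.

End metric.

(** * Closed sublevel sets, minima and nested intersections under compactness *)

Section continuous_sets.
Context (R : realType) (T : topologicalType).

Lemma closed_le_fun (f g : T -> R) : continuous f -> continuous g ->
  closed [set x | f x <= g x].
Proof.
move=> cf cg.
have -> : [set x | f x <= g x] = (fun x => f x - g x) @^-1` [set r | r <= 0].
  by apply/seteqP; split=> x /=; rewrite subr_le0.
apply: preimage_closed; last exact: closed_le.
by move=> x _; apply: cvgB; [exact: cf|exact: cg].
Qed.

Lemma compact_argmin (f : T -> R) (A : set T) : continuous f -> compact A ->
  A !=set0 -> exists2 c, A c & forall t, A t -> f c <= f t.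
Proof.
move=> cf cA A0; have [|c /set_mem Ac cmin] := @compact_EVT_min T R f A A0 cA.
  exact: continuous_subspaceT.
by exists c => // t At; apply: cmin; exact/mem_set.
Qed.

(** The sets [C n] generate a proper filter, and any cluster point of it lies in each closed
    [C n]. *)
Lemma nested_compact (C : nat -> set T) : compact [set: T] ->
  (forall n, closed (C n)) -> (forall n, C n !=set0) ->
  (forall n, C n.+1 `<=` C n) -> exists x, forall n, C n x.
Proof.
move=> cT cC C0 Cdecr.
have Cle m n : (m <= n)%N -> C n `<=` C m.
  elim: n => [|n IH]; first by rewrite leqn0 => /eqP ->.
  by rewrite leq_eqVlt => /predU1P[->//|/IH mn x /Cdecr/mn].
pose F := filter_from [set: nat] C.
have FF : ProperFilter F.
  apply: filter_from_proper => [|n _]; last exact: C0.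
  apply: filter_from_filter; first by exists 0%N.
  move=> i j _ _; exists (maxn i j) => // x Cx.
  by split; apply: Cle Cx; rewrite ?leq_maxl ?leq_maxr.
have [x [_ xF]] := cT F FF filterT.
exists x => n; apply: cC => A Ax; apply: xF => //.
by exists n.
Qed.

End continuous_sets.

(** * Borel measurability from preimages of open or closed sets *)

Section borel.
Context (R : realType).

Lemma open_measurable_borel (X : ptopologicalType) (A : set X) :
  open A -> measurable (A : set (borel X)).
Proof. by move=> oA; exact: sub_sigma_algebra. Qed.

Lemma closed_measurable_borel (X : ptopologicalType) (A : set X) :
  closed A -> measurable (A : set (borel X)).
Proof.
move=> cA; rewrite -(setCK A); apply: measurableC.
by apply: open_measurable_borel; rewrite openC.
Qed.

Lemma open_measurable_fun d (T : measurableType d) (X : ptopologicalType)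
    (f : T -> borel X) :
  (forall A : set X, open A -> measurable (f @^-1` A)) -> measurable_fun setT f.
Proof.
move=> fo; apply: (@measurability _ _ T (borel X) setT f (@open X)) => //.
by move=> _ [A oA <-]; rewrite setTI; exact: fo.
Qed.

Lemma closed_measurable_fun d (T : measurableType d) (X : ptopologicalType)
    (f : T -> borel X) :
  (forall A : set X, closed A -> measurable (f @^-1` A)) ->
  measurable_fun setT f.
Proof.
move=> fc; apply: open_measurable_fun => A oA; rewrite -(setCK A) -preimage_setC.
by apply/measurableC/fc; rewrite closedC.
Qed.

Lemma continuous_measurable_borel (X Y : ptopologicalType) (f : X -> Y) :
  continuous f -> measurable_fun setT (f : borel X -> borel Y).
Proof.
move=> cf; apply: open_measurable_fun => A oA.
apply: open_measurable_borel; move: A oA; exact/continuousP.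
Qed.

Lemma continuous_measurable_fun_real (X : ptopologicalType) (f : X -> R) :
  continuous f -> measurable_fun setT (f : borel X -> R).
Proof.
move=> cf; apply: (measurability _ (RGenOpens.measurableE R)).
move=> _ [_ [a [b ->]] <-].
rewrite setTI; apply: open_measurable_borel.
by have /continuousP := cf; apply; exact: interval_open.
Qed.

End borel.

(** * Countable bases and measurability into the product *)

Section separability.
Context (R : realType) (X : pmetricType R) (cptX : compact [set: X]).

Lemma countable_basis : exists B : nat -> set X, (forall n, open (B n)) /\
  forall x U, nbhs x U -> exists n, B n x /\ B n `<=` U.
Proof.
have [B cB [oB nB]] := compact_second_countable cptX.
(* The basis of a nonempty space is nonempty, so all of [nat] can enumerate it. *)
have [U0 [BU0 _] _] := nB point setT filterT.
have /pfcard_geP[B0|] := cB; first by rewrite B0 in BU0.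
move=> [f]; exists f; split=> [n|x U xU].
  by apply: oB; exact: funS.
have [V [BV Vx] VU] := nB x U xU.
by have [n _ fn] := 'surj_f BV; exists n; rewrite fn.
Qed.

Lemma separable_seq :
  exists e : nat -> X, forall x (r : R), 0 < r -> exists n, mdist x (e n) < r.
Proof.
have [B [oB nB]] := countable_basis.
(* One point from each basic set, with the default [point] where [B n] is empty. *)
exists (fun n => xget point (B n)) => x r r0.
have [|n [Bx Br]] := nB x (ball x r); first exact: nbhsx_ballx.
exists n; suff /Br : B n (xget point (B n)) by rewrite ballEmdist.
by apply: xgetPex; exists x.
Qed.

(** The sigma-algebra on pairs is generated by the product topology. A countable basis writes each
    open set as a countable union of rectangles, whose preimages are measurable. *)
Lemma measurable_borel_pair d (T : measurableType d) (f g : T -> borel X) :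
  measurable_fun setT f -> measurable_fun setT g ->
  measurable_fun setT (fun w => (f w, g w) : borel (X * X)%type).
Proof.
move=> mf mg; have [B [oB nB]] := countable_basis.
apply: open_measurable_fun => O oO.
have -> : (fun w => (f w, g w)) @^-1` O =
    \bigcup_n \bigcup_(k in [set k | B n `*` B k `<=` O])
      (f @^-1` (B n) `&` g @^-1` (B k)).
  apply/seteqP; split=> w /=; last first.
    by move=> [n _ [k /= nkO [Bf Bg]]]; apply: nkO.
  move=> Ow; have : nbhs (f w, g w) O by move: oO; rewrite openE; apply.
  move=> [[/= U V] [/nB[n [nf nU]] /nB[k [kg kV]]] UVO].
  exists n => //; exists k => // -[y z] [/= By Bz].
  by apply: UVO; split; [exact: nU|exact: kV].
apply: bigcup_measurable => n _; apply: bigcup_measurable => k _.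
by apply: measurableI; rewrite -[X in measurable X]setTI; [apply: mf|apply: mg] => //;
  exact: open_measurable_borel.
Qed.

End separability.

(** * Measurable selection from compact-valued correspondences *)

Section selection.
Context (R : realType) (X : pmetricType R) (cptX : compact [set: X]).
Context d (Om : measurableType d).

(* Weak (Effros) measurability of a closed-valued correspondence. *)
Definition measurable_corr (N : Om -> set X) :=
  [/\ forall w, closed (N w), forall w, N w !=set0 &
      forall C, closed C -> measurable [set w | N w `&` C !=set0]].

Definition corr_argmin (N : Om -> set X) (g : X -> R) (w : Om) : set X :=
  [set y | N w y /\ forall z, N w z -> g y <= g z].

Lemma closed_compact (C : set X) : closed C -> compact C.
Proof. by move=> cC; exact: subclosed_compact cC cptX _. Qed.

(** By compactness, the argmin meets [C] exactly when the minimum of [g] over [N w] equals its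
    minimum over the part of [N w] in [C]. Testing this with rational thresholds involves countably
    many hitting events. *)
Lemma measurable_corr_argmin N g : measurable_corr N -> continuous g ->
  measurable_corr (corr_argmin N g).
Proof.
move=> [cN N0 mN] cg.
have cle r : closed [set x | g x <= r].
  by apply: closed_le_fun => //; move=> x; exact: cvg_cst.
split=> [w|w|C cC].
- have -> : corr_argmin N g w =
      N w `&` \bigcap_(z in N w) [set x | g x <= g z] by [].
  by apply: closedI => //; apply: closed_bigI => z _; exact: cle.
- have [c Nc cmin] := compact_argmin cg (closed_compact (cN w)) (N0 w).
  by exists c.
have -> : [set w | corr_argmin N g w `&` C !=set0] =
    \bigcap_(q in @setT rat) (~` [set w | N w `&` [set x | g x <= ratr q] !=set0] `|`
      [set w | N w `&` (C `&` [set x | g x <= ratr q]) !=set0]).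
  apply/seteqP; split=> w /=.
    move=> [y [[Ny ymin] Cy]] q _.
    have [h|] := pselect (N w `&` [set x | g x <= ratr q] !=set0); last by left.
    right; exists y; split=> //; split=> //=; move: h => [z [Nz /= zq]].
    by rewrite (le_trans (ymin z Nz)).
  move=> H; have [c Nc cmin] := compact_argmin cg (closed_compact (cN w)) (N0 w).
  have {}H r : g c < r -> exists2 y, (N w `&` C) y & g y < r.
    move=> /rat_in_itvoo[q /[!in_itv]/= /andP[cq qr]].
    have [[]|[y [Ny [Cy /= yq]]]] := H q I.
      by exists c; split=> //=; exact: ltW.
    by exists y => //; exact: le_lt_trans yq qr.
  have cNC : compact (N w `&` C) by apply: closed_compact; apply: closedI.
  have [|y [Ny Cy] ymin] := compact_argmin cg cNC.
    have [|y NCy _] := H (g c + 1); first by rewrite ltrDl.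
    by exists y.
  exists y; split=> //; split=> // z Nz; rewrite (le_trans _ (cmin z Nz))//.
  rewrite leNgt; apply/negP => /H[y' NCy'].
  by rewrite ltNge ymin.
rewrite -[X in measurable X]setCK setC_bigcap; apply: measurableC.
apply: bigcupT_measurable_rat => q; apply: measurableC; apply: measurableU.
  by apply: measurableC; exact: mN.
by apply: mN; apply: closedI.
Qed.

(* Breaking ties successively by the distances to a dense sequence leaves a
   single point in each fibre. *)
Lemma measurable_selection_argmin N (phi : X -> R) :
  measurable_corr N -> continuous phi ->
  exists T : Om -> borel X, [/\ measurable_fun setT T, forall w, N w (T w) &
    forall w y, N w y -> phi (T w) <= phi y].
Proof.
move=> mN cphi; have [e eP] := separable_seq cptX.
pose F := fix F n := if n is n'.+1 then corr_argmin (F n') (mdist (e n'))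
                     else corr_argmin N phi.
have mF n : measurable_corr (F n).
  elim: n => [|n IH]; first exact: measurable_corr_argmin.
  by apply: measurable_corr_argmin => //; exact: continuous_mdistr.
have FS n w : F n.+1 w `<=` F n w by move=> y [].
have Funiq w y y' : (forall n, F n w y) -> (forall n, F n w y') -> y = y'.
  (* Both points minimize each [mdist (e n)] over the same fibre, so they are equidistant from
     [e n]. An [e n] closer to [y] than half of [mdist y y'] then contradicts the triangle
     inequality. *)
  move=> Fy Fy'; apply: (@mdist_positivity R X); apply/eqP.
  rewrite eq_le mdist_ge0 andbT leNgt; apply/negP => yy'.
  have [|n] := eP y (mdist y y' / 2); first by rewrite divr_gt0.
  have [_ /(_ _ (Fy' n))] := Fy n.+1.
  have [_ /(_ _ (Fy n))] := Fy' n.+1.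
  have := metric_triangle y (e n) y'; rewrite (metric_sym y (e n)).
  lra.
have FT w : exists y, forall n, F n w y.
  apply: nested_compact => // n; first by have [] := mF n.
  by have [_ + _] := mF n; exact.
have [T TF] := choice FT.
exists T; split; last 2 first.
- by move=> w; have [] := TF w 0%N.
- by move=> w y Ny; have [_] := TF w 0%N; exact.
apply: closed_measurable_fun => C cC.
(* If [C] meets every [F n w], nested compactness gives a common point in [C], which must be
   [T w]. *)
have -> : T @^-1` C = \bigcap_n [set w | F n w `&` C !=set0].
  apply/seteqP; split=> [w Cw n _|w FC]; first by exists (T w).
  have [|||y Fy] := @nested_compact X (fun n => F n w `&` C) cptX.
  - by move=> n; apply: closedI => //; have [] := mF n.
  - by move=> n; exact: FC.
  - by move=> n y [/FS].
  rewrite /preimage/= (Funiq w (T w) y)//; first by have [] := Fy 0%N.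
  by move=> n; have [] := Fy n.
by apply: bigcapT_measurable => n; have [_ _] := mF n; exact.
Qed.

End selection.

(** * Mixing two probability measures with equal weights *)

Section mixture.
Local Open Scope ereal_scope.
Context d (Om : measurableType d) (R : realType) (P1 P2 : probability Om R).

Definition mixture : set Om -> \bar R :=
  measure_add (mscale ((2^-1)%:nng)%R P1) (mscale ((2^-1)%:nng)%R P2).

HB.instance Definition _ := Measure.on mixture.

Lemma mixtureE A : mixture A = (2^-1)%:E * P1 A + (2^-1)%:E * P2 A.
Proof. by rewrite /mixture/= /measure_add/= /msum/= !big_ord_recl big_ord0 adde0. Qed.

Let mixture_setT : mixture setT = 1.
Proof. by rewrite mixtureE !probability_setT !mule1 -EFinD; congr EFin; lra. Qed.

HB.instance Definition _ := Measure_isProbability.Build _ _ _ mixture mixture_setT.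

End mixture.

(** * Integrals of bounded measurable functions *)

Section expectation.
Context d (Om : measurableType d) (R : realType) (P : probability Om R).
Implicit Types g h : Om -> R.

(** Gives integrability against every probability at once, in a form stable under sums and
    products. *)
Definition bounded_measurable g :=
  measurable_fun setT g /\ exists M, forall w, `|g w| <= M.

Lemma bounded_measurable_integrable g :
  bounded_measurable g -> P.-integrable setT (EFin \o g).
Proof.
move=> [mg [M gM]]; apply: measurable_bounded_integrable => //.
  by rewrite (le_lt_trans (probability_le1 P _))// ltry.
exists M; split; first exact: num_real.
by move=> r Mr w _; apply: le_trans (gM w) _; exact: ltW.
Qed.

Lemma bounded_measurable_cst r : bounded_measurable (fun=> r).
Proof. by split; [exact: measurable_cst|exists `|r|]. Qed.

Lemma bounded_measurableD g h : bounded_measurable g -> bounded_measurable h ->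
  bounded_measurable (fun w => g w + h w).
Proof.
move=> [mg [M gM]] [mh [N hN]]; split; first exact: measurable_funD.
by exists (M + N) => w; rewrite (le_trans (ler_normD _ _))// lerD.
Qed.

Lemma bounded_measurableM g h : bounded_measurable g -> bounded_measurable h ->
  bounded_measurable (fun w => g w * h w).
Proof.
move=> [mg [M gM]] [mh [N hN]]; split; first exact: measurable_funM.
by exists (M * N) => w; rewrite normrM ler_pM.
Qed.

Lemma bounded_measurableZ r g : bounded_measurable g ->
  bounded_measurable (fun w => r * g w).
Proof. exact/bounded_measurableM/bounded_measurable_cst. Qed.

Lemma bounded_measurable_indic A : measurable A ->
  bounded_measurable (\1_A : Om -> R).
Proof.
move=> mA; split; first exact: measurable_indic.
by exists 1 => w; rewrite indicE; case: (w \in A); rewrite ?normr1 ?normr0.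
Qed.

Lemma RintegralD_bounded g h : bounded_measurable g -> bounded_measurable h ->
  \int[P]_w (g w + h w) = \int[P]_w g w + \int[P]_w h w.
Proof. by move=> ? ?; rewrite RintegralD//; exact: bounded_measurable_integrable. Qed.

Lemma RintegralZ_bounded r g : bounded_measurable g ->
  \int[P]_w (r * g w) = r * \int[P]_w g w.
Proof. by move=> ?; rewrite RintegralZl//; exact: bounded_measurable_integrable. Qed.

Lemma Rintegral_prob_cst r : Rintegral P setT (fun=> r) = r.
Proof. by rewrite Rintegral_cst// [X in fine X](probability_setT P) mulr1. Qed.

Lemma Rintegral_indic A : measurable A -> \int[P]_w \1_A w = fine (P A).
Proof. by move=> mA; rewrite /Rintegral integral_indic// setIT. Qed.

Lemma le_Rintegral_bounded g h : bounded_measurable g -> bounded_measurable h ->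
  (forall w, g w <= h w) -> \int[P]_w g w <= \int[P]_w h w.
Proof.
by move=> ? ? gh; apply: le_Rintegral => //;
  exact: bounded_measurable_integrable.
Qed.

Lemma integral_bounded g : bounded_measurable g ->
  (\int[P]_w (g w)%:E)%E = (\int[P]_w g w)%:E.
Proof.
by move=> bg; rewrite /Rintegral fineK//; apply: integrable_fin_num => //;
  exact: bounded_measurable_integrable.
Qed.

(** The equation holds for every set [A], measurable or not, because a pushforward is defined
    through preimages; rewriting with it leaves no measurability condition. *)
Lemma prob_pushforward (X : ptopologicalType) (T : Om -> borel X) :
  measurable_fun setT T ->
  exists Q : Prob R X, forall A, Q A = P (T @^-1` A).
Proof.
by move=> mT; pose T' : {mfun Om >-> borel X} := mfun_Sub (mem_set mT);
  exists (distribution P T').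
Qed.

End expectation.

(** * Laws of random points and change of variables *)

Section law.
Context (R : realType) (X : ptopologicalType) (cptX : compact [set: X]).

Lemma continuous_bounded_measurable (g : X -> R) : continuous g ->
  @bounded_measurable _ (borel X) R g.
Proof.
move=> cg; split; first exact: continuous_measurable_fun_real.
have cng : continuous (fun x => - `|g x|).
  move=> x; by apply: cvgN; apply: cvg_norm; exact: cg.
have [|c _ cmax] := compact_argmin cng cptX; first by exists point.
by exists `|g c| => w; rewrite -lerN2; exact: cmax.
Qed.

Context d (Om : measurableType d).

Lemma bounded_measurable_comp (q : Om -> borel X) (g : X -> R) :
  measurable_fun setT q -> @bounded_measurable _ (borel X) R g ->
  bounded_measurable (g \o q).
Proof.
move=> mq [mg [M gM]]; split; first exact: measurableT_comp.
by exists M => w /=.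
Qed.

(** With random points on an arbitrary space [Om], one change of variables serves both the
    projections of a coupling and the graph of a map. *)
Definition has_law (P : probability Om R) (q : Om -> borel X) (nu : Prob R X) :=
  measurable_fun setT q /\
  forall A : set (borel X), measurable A -> P (q @^-1` A) = nu A.

Lemma Rintegral_law P q nu (g : X -> R) : has_law P q nu ->
  @bounded_measurable _ (borel X) R g -> \int[nu]_x g x = \int[P]_w g (q w).
Proof.
move=> [mq qnu] bg.
rewrite /Rintegral; congr fine.
rewrite -(integral_pushforward mq (D := setT) (f := EFin \o g))//.
- by apply: eq_measure_integral => A mA _; exact/esym/qnu.
- by apply/measurable_EFinP; case: bg.
- exact/bounded_measurable_integrable/bounded_measurable_comp.
Qed.

End law.

(** * Continuous functions determine a Borel probability measure *)

Section uniqueness.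
Context (R : realType) (X : pmetricType R).

(** The indicator of an open [U] is the pointwise limit of the continuous functions [phi n], which
    truncate [n] times the distance to the complement. Dominated convergence gives equality on open
    sets, a generating class stable under intersection. *)
Lemma borel_eq_continuous (nu1 nu2 : Prob R X) : compact [set: X] ->
  (forall phi : X -> R, continuous phi -> \int[nu1]_x phi x = \int[nu2]_x phi x) ->
  borel_eq nu1 nu2.
Proof.
move=> cptX nuE.
have openE (U : set X) : open U -> nu1 U = nu2 U.
  move=> oU; have cU : closed (~` U) by rewrite closedC.
  (* The whole space is treated apart: an empty complement has no meaningful distance. *)
  have [U0|/set0P U0] := eqVneq (~` U) set0.
    by rewrite -(setCK U) U0 setC0 !probability_setT.
  pose phi n x : R := Num.min 1 (n%:R * infdist (~` U) x).
  have cphi n : continuous (phi n).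
    move=> x; apply: (@continuous_min R X (fun=> 1)); first exact: cvg_cst.
    by apply: cvgM; [exact: cvg_cst|exact: continuous_infdist].
  have phi_ge0 n x : 0 <= phi n x.
    by rewrite le_min ler01 mulr_ge0// infdist_ge0.
  have lim (nu : Prob R X) : (\int[nu]_x (phi n x)%:E)%E @[n --> \oo] --> nu U.
    have mU : measurable (U : set (borel X)) by exact: open_measurable_borel.
    rewrite -[U in nu U]setIT -integral_indic//.
    have [| | | | |_ _] := @dominated_convergence _ (borel X) R nu setT measurableT
      (fun n x => (phi n x)%:E) (fun x => (\1_U x)%:E) (EFin \o cst 1).
    - by move=> n; apply/measurable_EFinP; exact: continuous_measurable_fun_real.
    - exact/measurable_EFinP/measurable_indic.
    - apply: aeW => x _; have [Ux|nUx] := pselect (U x); last first.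
        rewrite indicE memNset//; apply: cvg_near_cst; near=> n.
        by rewrite /phi infdist_mem// mulr0; congr EFin; apply/min_idPr.
      rewrite indicE mem_set//; apply: cvg_near_cst.
      have dx : 0 < infdist (~` U) x by apply: infdist_gt0 => //; exact.
      near=> n; congr EFin; apply/min_idPl.
      rewrite -ler_pdivrMr// mul1r; near: n; exact: nbhs_infty_ger.
    - exact/bounded_measurable_integrable/bounded_measurable_cst.
    - apply: aeW => x n _; rewrite lee_fin ger0_norm//.
      by rewrite ge_min lexx.
    by [].
  have := lim nu1; have -> : (fun n => \int[nu1]_x (phi n x)%:E)%E =
      (fun n => \int[nu2]_x (phi n x)%:E)%E.
    apply/funext => n; rewrite !integral_bounded ?nuE//;
      exact: continuous_bounded_measurable.
  by move=> /cvg_unique; apply => //; exact: lim.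
move=> A mA; apply: (@measure_unique _ R (borel X) (@open X) (fun=> setT)) => //.
- by move=> U V; exact: openI.
- by move=> _; exact: openT.
- by rewrite bigcup_const.
- by move=> k; rewrite (le_lt_trans (probability_le1 nu1 _))// ltry.
Unshelve. all: by end_near. Qed.

End uniqueness.

(** * Bounded diameter and nearest points in a compact space *)

Section compact_metric.
Context (R : realType) (X : pmetricType R) (cptX : compact [set: X]).

Lemma compact_pairT : compact [set: X * X].
Proof. by rewrite -setXTT; exact: compact_setX. Qed.

Lemma mdist_bounded : exists2 D : R, 0 <= D & forall x y : X, mdist x y <= D.
Proof.
have cnd : continuous (fun z : X * X => - mdist z.1 z.2).
  by move=> z; apply: cvgN; exact: continuous_mdist.
have [c _ cmax] := compact_argmin cnd compact_pairT (ex_intro _ point I).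
exists (mdist c.1 c.2); first exact: mdist_ge0.
by move=> x y; rewrite -lerN2; exact: (cmax (x, y)).
Qed.

Lemma infdist_attained (C : set X) (x : X) : closed C -> C !=set0 ->
  exists2 y, C y & mdist x y <= infdist C x.
Proof.
move=> cC C0.
have [y Cy ymin] := compact_argmin (@continuous_mdistr R X x) (closed_compact cptX cC) C0.
by exists y => //; exact: infdist_glb.
Qed.

End compact_metric.

(** * Nearest points in the zero set of [a], and the excess cost *)

Section penalization.
Context (R : realType) (X : pmetricType R) (cptX : compact [set: X]).
Variables (a : X -> R) (ca : continuous a) (a_ge0 : forall y, 0 <= a y)
  (a0 : exists y, a y = 0).

Let K := [set y | a y = 0].

Lemma closed_zeros : closed K.
Proof.
have -> : K = [set y | a y <= 0].
  by apply/seteqP; split=> y /=; [move=> ->|move=> ay; apply/eqP; rewrite eq_le ay a_ge0].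
by apply: closed_le_fun => //; move=> x; exact: cvg_cst.
Qed.

Definition nearest (x : X) : set X := [set y | K y /\ mdist x y <= infdist K x].

Lemma mdist_nearest x y : nearest x y -> mdist x y = infdist K x.
Proof. by move=> [Ky xy]; apply/eqP; rewrite eq_le xy infdist_le. Qed.

(** When [K] meets [C], the points with a nearest point in [C] are those whose distance to the
    intersection is at most their distance to [K]; this condition is closed. *)
Lemma nearest_corr : @measurable_corr R X _ (borel X) nearest.
Proof.
have K0 : K !=set0 by [].
split=> [x|x|C cC].
- have -> : nearest x = K `&` [set y | mdist x y <= infdist K x] by [].
  apply: closedI; first exact: closed_zeros.
  by apply: closed_le_fun; [exact: continuous_mdistr|move=> y; exact: cvg_cst].
- by have [y Ky xy] := infdist_attained cptX x closed_zeros K0; exists y.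
- apply: closed_measurable_borel.
  have [KC|/set0P KC] := eqVneq (K `&` C) set0.
    rewrite (_ : mkset _ = set0); first exact: closed0.
    rewrite -subset0 => x [y [[Ky _] Cy]].
    by have : (K `&` C) y by []; rewrite KC.
  have cKC : closed (K `&` C) by apply: closedI => //; exact: closed_zeros.
  rewrite (_ : mkset _ = [set x | infdist (K `&` C) x <= infdist K x]).
    by apply: closed_le_fun; exact: continuous_infdist.
  apply/seteqP; split=> x /=.
    by move=> [y [[Ky xy] Cy]]; rewrite (le_trans _ xy)// infdist_le.
  move=> xKC; have [y [Ky Cy] xy] := infdist_attained cptX x cKC KC.
  by exists y; split=> //; split=> //; exact: le_trans xKC.
Qed.

(** On the compact set where [g] is at least [tau], [a] does not vanish and so has a positive
    minimum. The maximum of [g] divided by that minimum serves as [C]. *)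
Lemma penalty_bound (g : X -> R) (tau : R) : continuous g -> 0 < tau ->
  (forall y, K y -> g y <= 0) ->
  exists2 C, 0 <= C & forall y, g y <= tau + C * a y.
Proof.
move=> cg tau0 gK; pose G := [set y | tau <= g y].
have [G0|/set0P G0] := eqVneq G set0.
  exists 0 => // y; rewrite mul0r addr0 leNgt; apply/negP => ty.
  have : G y by exact: ltW.
  by rewrite G0.
have cG : compact G.
  by apply: closed_compact => //; apply: closed_le_fun => //; move=> y; exact: cvg_cst.
have [c Gc cmin] := compact_argmin ca cG G0.
have ac : 0 < a c.
  rewrite lt_neqAle a_ge0 andbT; apply/eqP => /esym/gK.
  by rewrite leNgt (lt_le_trans tau0).
have cng : continuous (fun y => - g y) by move=> y; apply: cvgN; exact: cg.
have [M _ Mmax] := compact_argmin cng cptX (ex_intro _ point I).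
have gM : 0 <= g M.
  by rewrite (le_trans (ltW tau0))// (le_trans Gc)// -lerN2 Mmax.
exists (g M / a c); first by rewrite divr_ge0// ltW.
move=> y; have [ty|ty] := leP tau (g y); last first.
  by rewrite (le_trans (ltW ty))// lerDl mulr_ge0// divr_ge0// ltW.
rewrite (@le_trans _ _ (g M))//; first by rewrite -lerN2 Mmax.
rewrite -[leLHS]add0r lerD ?(ltW tau0)// mulrAC ler_pdivlMr//.
by rewrite ler_wpM2l// cmin.
Qed.

(** Extra cost of sending [x] to [y] rather than to a nearest point of [K]; it can be negative only
    for [y] outside [K]. *)
Definition gap (x y : X) : R := mdist x y ^+ 2 - infdist K x ^+ 2.

Lemma nearest_gap x y : nearest x y -> gap x y = 0.
Proof. by move=> /mdist_nearest xy; rewrite /gap xy subrr. Qed.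

Lemma gap_nearest x y : K y -> gap x y <= 0 -> nearest x y.
Proof.
move=> Ky; rewrite /gap subr_le0 ler_sqr ?nnegrE ?mdist_ge0 ?infdist_ge0//.
Qed.

Lemma continuous_gap : continuous (fun z : X * X => gap z.1 z.2).
Proof.
have cg : continuous (fun z : X * X => infdist K z.1).
  move=> z; apply: (@continuous_comp _ _ _ fst (infdist K)); first exact: cvg_fst.
  exact: continuous_infdist.
move=> z; rewrite /gap; under eq_fun do rewrite !expr2.
by apply: cvgB; apply: cvgM; solve [exact: continuous_mdist | exact: cg].
Qed.

(** Squaring the triangle inequality for the distance to [K] bounds the gap below by minus
    [3 * D * infdist K y]. This error vanishes on [K], so [penalty_bound] absorbs it. *)
Lemma gap_lower_bound (tau : R) : 0 < tau ->
  exists2 C, 0 <= C & forall x y, 0 <= gap x y + tau + C * a y.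
Proof.
have K0 : K !=set0 by [].
have [D D0 DP] := mdist_bounded cptX.
move=> tau0; have cD : continuous (fun y => 3 * D * infdist K y).
  by move=> y; apply: cvgM; [exact: cvg_cst|exact: continuous_infdist].
have [|C C0 CP] := penalty_bound cD tau0.
  by move=> y Ky; rewrite infdist_mem// mulr0.
exists C => // x y; have := CP y; rewrite /gap.
have := DP x y; have := mdist_ge0 x y; have := infdist_ge0 y K0.
have := infdist_ge0 x K0; have := infdist_triangle x y K0.
have : infdist K y <= D.
  by have [z Kz] := K0; rewrite (le_trans (infdist_le y Kz)).
move: (mdist x y) (infdist K x) (infdist K y) (C * a y) => d u v w.
move=> vD ud u0 v0 d0 dD vw.
have : u ^+ 2 <= (d + v) ^+ 2 by rewrite ler_sqr ?nnegrE ?addr_ge0.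
nra.
Qed.

End penalization.

(** * Stability of nearly optimal transports *)

Section stability.
Context (R : realType) (X : pmetricType R) (cptX : compact [set: X]).
Variables (a : X -> R) (ca : continuous a) (a_ge0 : forall y, 0 <= a y)
  (a0 : exists y, a y = 0).

(** A triple [(x, (y, z))] records two targets for [x], both optimal up to [rho], that [phi]
    separates by at least [eta]. *)
Definition ties_graph (phi : X -> R) (eta rho : R) : set (X * (X * X)) :=
  [set w | [/\ a w.2.1 <= rho, a w.2.2 <= rho,
    gap a w.1 w.2.1 <= rho, gap a w.1 w.2.2 <= rho & eta <= phi w.2.1 - phi w.2.2]].

Definition ties phi eta rho : set X := [set w.1 | w in ties_graph phi eta rho].

Lemma closed_ties_graph phi eta rho : continuous phi ->
  closed (ties_graph phi eta rho).
Proof.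
move=> cphi.
have c21 : continuous (fun w : X * (X * X) => w.2.1).
  by move=> w; apply: (@continuous_comp _ _ _ snd fst); [exact: cvg_snd|exact: cvg_fst].
have c22 : continuous (fun w : X * (X * X) => w.2.2).
  by move=> w; apply: (@continuous_comp _ _ _ snd snd); exact: cvg_snd.
have cc (h : X -> R) (k : X * (X * X) -> X) : continuous h -> continuous k ->
    continuous (fun w => h (k w)).
  by move=> ch ck w; apply: continuous_comp; [exact: ck|exact: ch].
have cgap (k : X * (X * X) -> X) : continuous k ->
    continuous (fun w => gap a w.1 (k w)).
  move=> ck w.
  apply: (@continuous_comp _ _ _ (fun w => (w.1, k w)) (fun z => gap a z.1 z.2)).
    by apply: cvg_pair; [exact: cvg_fst|exact: ck].
  exact: continuous_gap.
have cr r : continuous (fun _ : X * (X * X) => r : R) by move=> x; exact: cvg_cst.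
have -> : ties_graph phi eta rho =
    [set w | a w.2.1 <= rho] `&` [set w | a w.2.2 <= rho] `&`
    [set w | gap a w.1 w.2.1 <= rho] `&` [set w | gap a w.1 w.2.2 <= rho] `&`
    [set w | eta <= phi w.2.1 - phi w.2.2].
  by apply/seteqP; split=> w /=; [case|move=> [[[[]]]]].
repeat apply: closedI; apply: closed_le_fun; try exact: cr;
  try exact: cgap; try exact: cc.
by move=> w; apply: cvgB; [exact: (cc phi _ cphi c21)|exact: (cc phi _ cphi c22)].
Qed.

(** The projection of a compact set is compact, hence closed. This makes [ties] a Borel set. *)
Lemma closed_ties phi eta rho : continuous phi -> closed (ties phi eta rho).
Proof.
move=> cphi; apply: compact_closed; first exact: metric_hausdorff.
apply: continuous_compact.
  by apply: continuous_subspaceT => w; exact: cvg_fst.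
have cXXX : compact [set: X * (X * X)].
  by rewrite -!setXTT; do 2?apply: compact_setX.
by apply: (subclosed_compact _ cXXX) => //; exact: closed_ties_graph.
Qed.

Lemma ties_graph_le phi eta rho rho' : rho <= rho' ->
  ties_graph phi eta rho `<=` ties_graph phi eta rho'.
Proof. by move=> rr w [? ? ? ? ?]; split=> //; exact: le_trans rr. Qed.

(** Over a fixed [x] the fibres of [ties_graph] are nested compact sets. At a common point [a] and
    [gap] are below every [1/(n+1)], so both targets are exact nearest points. *)
Lemma bigcap_ties phi eta x : continuous phi ->
  (forall n, ties phi eta n.+1%:R^-1 x) ->
  exists y z, [/\ nearest a x y, nearest a x z & eta <= phi y - phi z].
Proof.
move=> cphi Sx; pose G n := [set z | ties_graph phi eta n.+1%:R^-1 (x, z)].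
have le0 (r : R) : (forall n, r <= n.+1%:R^-1) -> r <= 0.
  move=> rn; rewrite leNgt; apply/negP => r0.
  by have [n] := ltr_add_invr r0; rewrite add0r ltNge rn.
have [|||[y z] Gz] := @nested_compact _ G (compact_pairT cptX).
- have cx : continuous (fun z : X * X => (x, z)).
    move=> z; apply: (@cvg_pair _ _ _ (nbhs z) (nbhs x) (nbhs z)) => //.
    exact: cvg_cst.
  move=> n; apply:
    (@preimage_closed _ _ (fun z => (x, z)) (ties_graph phi eta n.+1%:R^-1)).
    by move=> z _; exact: cx.
  exact: closed_ties_graph.
- by move=> n; have [[x' z] Gz /= xx] := Sx n; exists z; move: Gz; rewrite xx.
- move=> n z; apply: ties_graph_le.
  by rewrite lef_pV2 ?posrE// ler_nat.
have a0' (u : X) : a u <= 0 -> a u = 0.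
  by move=> au; apply/eqP; rewrite eq_le au a_ge0.
exists y, z; split.
- by apply: gap_nearest => //; [apply: a0'|]; apply: le0 => n; have [] := Gz n.
- by apply: gap_nearest => //; [apply: a0'|]; apply: le0 => n; have [] := Gz n.
- by have [] := Gz 0%N.
Qed.

Variable m : Prob R X.

(** Almost everywhere uniqueness of the selection, tested against continuous functions;
    [regular_selections_ae_eq] derives it from regularity. *)
Hypothesis selections_ae_eq : forall (T1 T2 : borel X -> borel X)
    (phi : X -> R) (eta : R),
  measurable_fun setT T1 -> measurable_fun setT T2 ->
  (forall x, nearest a x (T1 x)) -> (forall x, nearest a x (T2 x)) ->
  continuous phi -> 0 < eta ->
  m [set x | eta <= phi (T1 x) - phi (T2 x)] = 0%E.

(** As [rho] shrinks, [ties] decreases to points where two exact nearest points differ in [phi] by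
    [eta]. There the selections maximizing and minimizing [phi] differ as much, so the limit set is
    null and continuity from above applies. *)
Lemma ties_small phi eta e : continuous phi -> 0 < eta -> 0 < e ->
  exists2 rho, 0 < rho & (m (ties phi eta rho) <= e%:E)%E.
Proof.
move=> cphi eta0 e0; pose F n := ties phi eta n.+1%:R^-1.
have mF n : measurable (F n : set (borel X)).
  by apply: closed_measurable_borel; exact: closed_ties.
have mS : measurable (\bigcap_n F n : set (borel X)).
  by apply: bigcapT_measurable.
have corr := nearest_corr cptX ca a_ge0 a0.
have [T2 [mT2 NT2 T2min]] := measurable_selection_argmin cptX corr cphi.
(* Minimizing [- phi] makes [T1] the selection that maximizes [phi]. *)
have cnphi : continuous (fun y => - phi y) by move=> y; apply: cvgN; exact: cphi.
have [T1 [mT1 NT1 T1min]] := measurable_selection_argmin cptX corr cnphi.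
have S0 : m (\bigcap_n F n) = 0%E.
  apply/eqP; rewrite eq_le measure_ge0 andbT.
  rewrite -(selections_ae_eq mT1 mT2 NT1 NT2 cphi eta0); apply: le_measure.
  - by rewrite inE.
  - rewrite inE -[X in measurable X]setTI.
    have mphi := @continuous_measurable_fun_real R X phi cphi.
    have mB : measurable_fun [set: borel X] (fun x => phi (T1 x) - phi (T2 x)).
      by apply: measurable_funB; exact: (measurableT_comp mphi).
    have := mB measurableT _ (@measurable_itv R `[eta, +oo[).
    by congr measurable; apply/seteqP; split=> x; rewrite /= in_itv/= andbT.
  - move=> x Sx /=; have [|y [z [Ny Nz]]] := @bigcap_ties phi eta x cphi.
      by move=> n; exact: Sx.
    have := T1min x y Ny; have := T2min x z Nz; lra.
have Fcvg : (m \o F) x @[x --> \oo] --> 0%E.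
  rewrite -S0; apply: nonincreasing_cvg_mu => //.
    by rewrite (le_lt_trans (probability_le1 m _))// ltry.
  move=> i j ij; apply/subsetPset => _ [w Fw <-]; exists w => //.
  by apply: ties_graph_le Fw; rewrite lef_pV2 ?posrE// ler_nat.
have [n _ nF] : \forall n \near \oo, (m (F n) < e%:E)%E.
  apply: (Fcvg [set x | (x < e%:E)%E]); apply: open_ereal_lt'.
  by rewrite lte_fin.
by exists n.+1%:R^-1 => //; rewrite ltW// nF//=.
Qed.

(* With [D := phi (q w) - phi (T (p w))]: either [D] is at most [eta], or [p w]
   lies in [ties], or [q w] fails one of the two near-optimality conditions
   [a <= rho], [gap <= rho], which Markov's inequality controls. *)
Lemma stability (T : borel X -> borel X) (phi : X -> R) (e : R) :
  measurable_fun setT T -> (forall x, nearest a x (T x)) ->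
  continuous phi -> 0 < e ->
  exists2 dl, 0 < dl & forall d (Om : measurableType d) (P : probability Om R)
    (p q : Om -> borel X),
    has_law P p m -> measurable_fun setT q ->
    \int[P]_w a (q w) <= dl -> \int[P]_w gap a (p w) (q w) <= dl ->
    \int[P]_w phi (q w) <= \int[m]_x phi (T x) + e.
Proof.
move=> mT NT cphi e0.
have [M M0 phiM] : exists2 M : R, 0 < M & forall y z, phi y - phi z <= M.
  have [_ [M phiM]] := continuous_bounded_measurable cptX cphi.
  exists (`|M| + `|M| + 1); first by rewrite ltr_wpDl ?addr_ge0.
  move=> y z; have := phiM y; have := phiM z; have := ler_norm M.
  rewrite !ler_norml; lra.
have e40 : 0 < e / 4 by rewrite divr_gt0.
(* The error [e] is split into four quarters: the threshold [e / 4], [M] times the measure of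
   [ties], [L * tau], and [L * (C + 2) * dl]. *)
have [rho rho0 mties] := ties_small cphi e40 (divr_gt0 e40 M0).
have tau0 : 0 < e / 4 / (M / rho) by rewrite !divr_gt0.
have [C C0 gapC] := gap_lower_bound cptX ca a_ge0 a0 tau0.
set L := M / rho in tau0 gapC; have L0 : 0 < L by rewrite divr_gt0.
set tau := e / 4 / L in tau0 gapC.
have C20 : 0 < C + 2 by rewrite ltr_wpDl.
pose dl := e / 4 / (L * (C + 2)).
exists dl; first by rewrite divr_gt0// mulr_gt0.
move=> d Om P p q pm mq aq gapq.
have [mp pE] := pm.
have bphi := continuous_bounded_measurable cptX cphi.
have bA : bounded_measurable (\1_(p @^-1` ties phi (e / 4) rho) : Om -> R).
  apply: bounded_measurable_indic; rewrite -[X in measurable X]setTI.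
  by apply: mp => //; apply: closed_measurable_borel; exact: closed_ties.
have bgap : bounded_measurable (fun w => gap a (p w) (q w)).
  have bg := continuous_bounded_measurable (compact_pairT cptX) (continuous_gap a0).
  exact: (bounded_measurable_comp (measurable_borel_pair cptX mp mq) bg).
have ba : bounded_measurable (fun w => a (q w)).
  exact: (bounded_measurable_comp mq (continuous_bounded_measurable cptX ca)).
have bphiq : bounded_measurable (fun w => phi (q w)).
  exact: (bounded_measurable_comp mq bphi).
have bphiT : @bounded_measurable _ (borel X) R (fun x => phi (T x)).
  exact: (bounded_measurable_comp mT bphi).
rewrite (Rintegral_law pm bphiT).
have bphiTp : bounded_measurable (fun w => phi (T (p w))).
  exact: (bounded_measurable_comp mp bphiT).
(* The coefficient of [a] is [L] for Markov's inequality plus [L * C], which together with [L * tau]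
   offsets a negative gap. Adding the coefficient [L] of the gap gives the factor [C + 2] in
   [dl]. *)
pose bnd w := phi (T (p w)) + M * \1_(p @^-1` ties phi (e / 4) rho) w +
  (L * (C + 1) * a (q w) + (L * gap a (p w) (q w) + (e / 4 + L * tau))).
have phi_le w : phi (q w) <= bnd w.
  have M1 : 0 <= M * \1_(p @^-1` ties phi (e / 4) rho) w by rewrite mulr_ge0// ltW.
  have := phiM (q w) (T (p w)); have La := mulr_ge0 (ltW L0) (a_ge0 (q w)).
  have := mulr_ge0 (ltW L0) (gapC (p w) (q w)).
  have LCa := mulr_ge0 (mulr_ge0 (ltW L0) C0) (a_ge0 (q w)).
  have Ltau := mulr_gt0 L0 tau0.
  have MLrho : M = L * rho by rewrite /L divfK// gt_eqF.
  (* Above [rho], the term [L * a (q w)] alone exceeds the oscillation bound [M]; the gap is handled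
     likewise. *)
  rewrite /bnd; have [arho|arho] := ltP rho (a (q w)).
    have : M < L * a (q w) by rewrite MLrho ltr_pM2l.
    move: M1; lra.
  have [grho|grho] := ltP rho (gap a (p w) (q w)).
    have : M < L * gap a (p w) (q w) by rewrite MLrho ltr_pM2l.
    move: M1; lra.
  have [ephi|] := leP (e / 4) (phi (q w) - phi (T (p w))); last first.
    by move: M1; lra.
  rewrite indicE mem_set ?mulr1; first lra.
  (* Here [q w] and [T (p w)] are two nearly optimal targets of [p w] separated by [phi]. *)
  exists (p w, (q w, T (p w))) => //; split=> //=.
    by rewrite (NT (p w)).1 ltW.
  by rewrite nearest_gap// ltW.
have bLa := bounded_measurableZ (L * (C + 1)) ba.
have bLg := bounded_measurableZ L bgap.
have bcst := bounded_measurable_cst Om (e / 4 + L * tau).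
have bgc := bounded_measurableD bLg bcst.
have bMA := bounded_measurableZ M bA.
have bagc := bounded_measurableD bLa bgc.
have bD := bounded_measurableD bphiTp bMA.
have hle := le_Rintegral_bounded P bphiq (bounded_measurableD bD bagc) phi_le. 
apply: (le_trans hle).
rewrite (RintegralD_bounded P bD bagc) (RintegralD_bounded P bphiTp bMA).
rewrite (RintegralD_bounded P bLa bgc) (RintegralD_bounded P bLg bcst).
rewrite (RintegralZ_bounded P _ bA) (RintegralZ_bounded P _ ba).
rewrite (RintegralZ_bounded P _ bgap) Rintegral_prob_cst -addrA lerD2l.
rewrite Rintegral_indic; last first.
  rewrite -[X in measurable X]setTI; apply: mp => //.
  by apply: closed_measurable_borel; exact: closed_ties.
have -> : P (p @^-1` ties phi (e / 4) rho) = m (ties phi (e / 4) rho).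
  by apply: pE; apply: closed_measurable_borel; exact: closed_ties.
have mA : M * fine (m (ties phi (e / 4) rho)) <= e / 4.
  rewrite mulrC -ler_pdivlMr// -lee_fin fineK//.
  apply: fin_num_measure; apply: closed_measurable_borel; exact: closed_ties.
have Ltau : L * tau = e / 4 by rewrite /tau mulrC divfK// gt_eqF.
have Ldl : L * (C + 2) * dl = e / 4.
  by rewrite /dl mulrC divfK// gt_eqF// mulr_gt0.
have := ler_wpM2l (ltW L0) gapq.
have LC1 : 0 <= L * (C + 1) by apply: mulr_ge0; [exact: ltW|exact: addr_ge0].
have := ler_wpM2l LC1 aq.
move: mA Ltau Ldl.
clearbody tau dl; lra.
Qed.

End stability.

(** * Transport cost into the zero set, and selections under regularity *)

Lemma Rintegral_eq0 d (Om : measurableType d) (R : realType)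
    (P : probability Om R) (E : set Om) (g : Om -> R) :
  measurable E -> P (~` E) = 0%E -> measurable_fun setT g ->
  (forall w, E w -> g w = 0) -> \int[P]_w g w = 0.
Proof.
move=> mE PE mg gE; rewrite /Rintegral.
rewrite (@ae_eq_integral _ _ _ P setT (cst 0%E) (EFin \o g))//.
- by rewrite integral_cst// mul0e.
- exact/measurable_EFinP.
- exists (~` E); split=> //; first exact: measurableC.
  by move=> w /= gw Ew; apply: gw => _; rewrite gE.
Qed.

Section optimal.
Context (R : realType) (X : pmetricType R) (cptX : compact [set: X]).

Lemma coupling_has_law (mu nu : Prob R X) gamma : coupling mu nu gamma ->
  has_law gamma (fst : borel (X * X)%type -> borel X) mu /\
  has_law gamma (snd : borel (X * X)%type -> borel X) nu.
Proof.
move=> [g1 g2]; split; split.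
- by apply: (@continuous_measurable_borel _ X) => z; exact: cvg_fst.
- by move=> A mA; exact: g1.
- by apply: (@continuous_measurable_borel _ X) => z; exact: cvg_snd.
- by move=> A mA; exact: g2.
Qed.

Lemma bounded_measurable_sqdist :
  @bounded_measurable _ (borel (X * X)%type) R (fun z => mdist z.1 z.2 ^+ 2).
Proof.
apply: (@continuous_bounded_measurable R (X * X)%type); first exact: compact_pairT.
by move=> z; under eq_fun do rewrite expr2; apply: cvgM; exact: continuous_mdist.
Qed.

Lemma costE (gamma : Prob R (X * X)%type) :
  cost gamma = (\int[gamma]_z (mdist z.1 z.2 ^+ 2))%:E.
Proof. by rewrite /cost /sqdist integral_bounded//; exact: bounded_measurable_sqdist. Qed.

Variables (a : X -> R) (ca : continuous a) (a_ge0 : forall y, 0 <= a y)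
  (a0 : exists y, a y = 0).

Let K := [set y | a y = 0].

Definition sqdist_to (m : Prob R X) : R := \int[m]_x (infdist K x ^+ 2).

Lemma bounded_measurable_infdist :
  @bounded_measurable _ (borel X) R (fun x => infdist K x ^+ 2).
Proof.
apply: continuous_bounded_measurable => // x.
by under eq_fun do rewrite expr2; apply: cvgM; exact: continuous_infdist.
Qed.

Section law.
Context (m : Prob R X) d (Om : measurableType d) (P : probability Om R)
  (p q : Om -> borel X).
Hypotheses (pm : has_law P p m) (mq : measurable_fun setT q).

Lemma bounded_measurable_gap : bounded_measurable (fun w => gap a (p w) (q w)).
Proof.
have bg := continuous_bounded_measurable (compact_pairT cptX) (continuous_gap a0).
case: pm => mp _.
exact: (bounded_measurable_comp (measurable_borel_pair cptX mp mq) bg).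
Qed.

(** The cost splits into a part fixed by [m] and [K] and the mean gap, so comparing costs amounts to
    comparing mean gaps. *)
Lemma Rintegral_sqdist_gap : \int[P]_w (mdist (p w) (q w) ^+ 2) =
  sqdist_to m + \int[P]_w gap a (p w) (q w).
Proof.
have bK := bounded_measurable_infdist.
have [mp _] := pm; rewrite /sqdist_to (Rintegral_law pm bK).
rewrite -(RintegralD_bounded P (bounded_measurable_comp mp bK) bounded_measurable_gap).
by congr Rintegral; apply/funext => w; rewrite /gap addrC subrK.
Qed.

(** Integrating [gap_lower_bound] removes the penalty term; taking for [tau] half the supposed
    deficit gives a contradiction. *)
Lemma Rintegral_gap_ge0 : \int[P]_w a (q w) = 0 ->
  0 <= \int[P]_w gap a (p w) (q w).
Proof.
move=> aq; rewrite leNgt; apply/negP; rewrite -oppr_gt0 => gap0.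
have [C C0 gapC] := gap_lower_bound cptX ca a_ge0 a0 (divr_gt0 gap0 (ltr0Sn _ 1)).
set tau := (_ / _) in gapC.
have ba := bounded_measurable_comp mq (continuous_bounded_measurable cptX ca).
have bCa := bounded_measurableZ C ba.
have bt := bounded_measurable_cst Om tau.
have bg := bounded_measurable_gap.
have := le_Rintegral_bounded P (bounded_measurable_cst Om 0)
  (bounded_measurableD (bounded_measurableD bg bt) bCa) (fun w => gapC (p w) (q w)).
rewrite (RintegralD_bounded P (bounded_measurableD bg bt) bCa).
rewrite (RintegralD_bounded P bg bt) (RintegralZ_bounded P _ ba) !Rintegral_prob_cst.
rewrite [X in C * X]aq /tau.
move: gap0; lra.
Qed.

End law.

(** The even mixture of the graphs of [T1] and [T2] has mean gap zero, so it is an optimal coupling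
    of [m] with its second marginal. Regularity puts it on the graph of one map [T]; as both graphs
    carry positive weight, each selection differs from [T] in [phi] by less than [eta / 2] almost
    everywhere. *)
Lemma regular_selections_ae_eq (m : Prob R X) : regular_mms m ->
  forall (T1 T2 : borel X -> borel X) (phi : X -> R) (eta : R),
  measurable_fun setT T1 -> measurable_fun setT T2 ->
  (forall x, nearest a x (T1 x)) -> (forall x, nearest a x (T2 x)) ->
  continuous phi -> 0 < eta ->
  m [set x | eta <= phi (T1 x) - phi (T2 x)] = 0%E.
Proof.
move=> reg T1 T2 phi eta mT1 mT2 NT1 NT2 cphi eta0.
have mid : measurable_fun setT (id : borel X -> borel X) by exact: measurable_id.
have [Q1 Q1E] := prob_pushforward m (measurable_borel_pair cptX mid mT1).
have [Q2 Q2E] := prob_pushforward m (measurable_borel_pair cptX mid mT2).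
pose gamma : Prob R (X * X)%type := mixture Q1 Q2.
have gE A : gamma A = ((2^-1)%:E * m [set x | A (x, T1 x)] +
    (2^-1)%:E * m [set x | A (x, T2 x)])%E.
  have <- : Q1 A = m [set x | A (x, T1 x)] by rewrite Q1E.
  have <- : Q2 A = m [set x | A (x, T2 x)] by rewrite Q2E.
  exact: mixtureE.
have msnd : measurable_fun setT (snd : borel (X * X)%type -> borel X).
  by apply: (@continuous_measurable_borel _ X) => z; exact: cvg_snd.
have mfst : measurable_fun setT (fst : borel (X * X)%type -> borel X).
  by apply: (@continuous_measurable_borel _ X) => z; exact: cvg_fst.
have [nu nuE] := prob_pushforward gamma msnd.
have gcoup : coupling m nu gamma.
  split=> A mA; last by rewrite nuE.
  have half : ((2^-1)%:E + (2^-1)%:E = 1 :> \bar R)%E.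
    by rewrite -EFinD; congr EFin; lra.
  by rewrite /pushforward gE/= -ge0_muleDl ?lee_fin// half mul1e.
have g0 (E : set (X * X)) : (forall x, E (x, T1 x)) -> (forall x, E (x, T2 x)) ->
    gamma (~` E) = 0%E.
  move=> E1 E2; rewrite gE.
  have -> : [set x | (~` E) (x, T1 x)] = set0 by rewrite -subset0 => x; apply; exact: E1.
  have -> : [set x | (~` E) (x, T2 x)] = set0 by rewrite -subset0 => x; apply; exact: E2.
  by rewrite measure0 mule0 adde0.
have [gm gnu] := coupling_has_law gcoup.
have ba := continuous_bounded_measurable cptX ca.
have nua : \int[nu]_y a y = 0.
  rewrite (Rintegral_law gnu ba).
  apply: (@Rintegral_eq0 _ (borel (X * X)%type) R gamma [set z | a z.2 = 0]) => //.
  - have mK : measurable (K : set (borel X)).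
      by apply: closed_measurable_borel; exact: closed_zeros.
    by have := msnd measurableT _ mK; rewrite setTI.
  - by apply: g0 => x /=; [have [] := NT1 x|have [] := NT2 x].
  - by have [] := bounded_measurable_comp msnd ba.
have bgap := bounded_measurable_gap gm msnd.
have ggap : \int[gamma]_z gap a z.1 z.2 = 0.
  apply: (@Rintegral_eq0 _ (borel (X * X)%type) R gamma
    [set z | gap a z.1 z.2 = 0]) => //.
  - have [mg _] := bgap.
    have := mg measurableT [set 0] (measurable_set1 0); rewrite setTI.
    by congr measurable.
  - by apply: g0 => x /=; apply: nearest_gap.
  - by have [] := bgap.
(* Every competitor has the same second marginal, hence mean excess zero and a nonnegative mean
   gap. *)
have gopt : argmin (coupling m nu) (@cost R X) gamma.
  split=> // gamma' gcoup'; have [gm' gnu'] := coupling_has_law gcoup'.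
  rewrite !costE lee_fin (Rintegral_sqdist_gap gm msnd).
  rewrite (Rintegral_sqdist_gap gm' msnd) ggap lerD2l.
  by apply: (Rintegral_gap_ge0 gm' msnd); rewrite -nua (Rintegral_law gnu' ba).
have [T mT gT] := reg nu gamma gopt.
have mphi := @continuous_measurable_fun_real R X phi cphi.
have mdiff d (Om : measurableType d) (u v : Om -> borel X) :
    measurable_fun setT u -> measurable_fun setT v ->
    measurable [set w | eta / 2 <= `|phi (u w) - phi (v w)|].
  move=> mu mv; have mB : measurable_fun setT (fun w => `|phi (u w) - phi (v w)|).
    apply: measurableT_comp => //.
    by apply: measurable_funB; exact: (measurableT_comp mphi).
  have := mB measurableT _ (@measurable_itv R `[eta / 2, +oo[).
  by rewrite setTI; congr measurable; apply/seteqP; split=> x; rewrite /= in_itv/= andbT.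
pose E := [set z : borel (X * X)%type | eta / 2 <= `|phi z.2 - phi (T z.1)|].
have mE : measurable E by apply: mdiff => //; exact: measurableT_comp mfst.
have gE0 : gamma E = 0%E.
  rewrite gT// /pushforward (_ : _ @^-1` _ = set0) ?measure0//.
  rewrite -subset0 => x; rewrite /E/= subrr normr0.
  by rewrite leNgt divr_gt0.
have mE1 : measurable [set x : borel X | eta / 2 <= `|phi (T1 x) - phi (T x)|].
  exact: mdiff.
have mE2 : measurable [set x : borel X | eta / 2 <= `|phi (T2 x) - phi (T x)|].
  exact: mdiff.
have [m1 m2] : m [set x | eta / 2 <= `|phi (T1 x) - phi (T x)|] = 0%E /\
               m [set x | eta / 2 <= `|phi (T2 x) - phi (T x)|] = 0%E.
  move: gE0; rewrite gE /E/= => /eqP; rewrite padde_eq0 ?mule_ge0//.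
  by rewrite !mule_eq0 !eqe invr_eq0 pnatr_eq0/= => /andP[/eqP-> /eqP->].
have mS : measurable [set x : borel X | eta <= phi (T1 x) - phi (T2 x)].
  have mB : measurable_fun [set: borel X] (fun x => phi (T1 x) - phi (T2 x)).
    by apply: measurable_funB; exact: (measurableT_comp mphi).
  have := mB measurableT _ (@measurable_itv R `[eta, +oo[).
  by rewrite setTI; congr measurable; apply/seteqP; split=> x; rewrite /= in_itv/= andbT.
(* A difference of at least [eta] forces one of the two differences from [T] to reach [eta / 2]. *)
rewrite -(measureU0 mE1 mE2 m2) in m1.
apply: (subset_measure0 mS (measurableU _ _ mE1 mE2) _ m1) => x /= Sx.
have [|T1x] := leP (eta / 2) `|phi (T1 x) - phi (T x)|; first by left.
right; rewrite leNgt; apply/negP => T2x; move: T1x T2x Sx.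
rewrite !ltr_norml; lra.
Qed.

End optimal.

(** * Symmetry and sign of [W2sq], and measures supported in a closed set *)

Section wasserstein_symmetry.
Context (R : realType) (X : pmetricType R) (cptX : compact [set: X]).
Implicit Types mu nu : Prob R X.

Lemma coupling_swap mu nu gamma : coupling mu nu gamma ->
  exists2 gamma', coupling nu mu gamma' & cost gamma' = cost gamma.
Proof.
move=> gc; have [[mfst gmu] [msnd gnu]] := coupling_has_law gc.
have mswap := measurable_borel_pair cptX msnd mfst.
have [gamma' g'E] := prob_pushforward gamma mswap.
exists gamma'; first by split=> A mA; rewrite /pushforward g'E; [exact: gnu|exact: gmu].
rewrite !costE//; congr EFin.
have swap_law : has_law gamma
    (fun z : borel (X * X)%type => (z.2, z.1) : borel (X * X)%type) gamma'.
  by split=> // A mA; rewrite g'E.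
rewrite (Rintegral_law swap_law (bounded_measurable_sqdist cptX)).
by congr Rintegral; apply/funext => z /=; rewrite metric_sym.
Qed.

Lemma W2sq_sym mu nu : W2sq mu nu = W2sq nu mu.
Proof.
suff le mu' nu' : (W2sq mu' nu' <= W2sq nu' mu')%E.
  by apply/eqP; rewrite eq_le !le.
apply/ereal_infP => _ [gamma gc <-].
have [gamma' gc' <-] := coupling_swap gc.
by apply: ereal_inf_lbound; exists gamma'.
Qed.

Lemma W2sq_ge0 mu nu : (0 <= W2sq mu nu)%E.
Proof.
apply/ereal_infP => _ [gamma gc <-]; rewrite costE// lee_fin.
by apply: Rintegral_ge0 => z _; exact: sqr_ge0.
Qed.

(** Each point outside [C] has a null open neighbourhood, hence a null basic one, and countably many
    of these cover the complement. *)
Lemma supp_sub_null nu (C : set X) : closed C -> supp nu `<=` C -> nu (~` C) = 0%E.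
Proof.
move=> cC sC; have [B [oB nB]] := countable_basis cptX.
(* [F n] is [B n] when that basic set is null, and empty otherwise. *)
pose F n : set (borel X) := [set x | B n x /\ nu (B n) = 0%E].
have mC : measurable (~` C : set (borel X)).
  by apply: open_measurable_borel; rewrite openC.
suff : nu.-negligible (~` C) by move=> /negligibleP; exact.
apply: (@negligibleS _ _ _ _ (\bigcup_n F n)).
  move=> x nCx; have [U xU nU] : exists2 U, open_nbhs x U & nu U = 0%E.
    have : ~ supp nu x by move=> /sC.
    move=> /existsNP[U /not_implyP[xU nuU]]; exists U => //.
    by apply/eqP; rewrite eq_le measure_ge0 andbT leNgt; apply/negP.
  have [n [Bx BU]] := nB x U (open_nbhs_nbhs xU).
  exists n => //; split=> //; apply: (@subset_measure0 _ (borel X) R nu (B n) U) => //.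
    exact: open_measurable_borel.
  by apply: open_measurable_borel; case: xU.
apply: negligible_bigcup => n.
have [n0|n0] := pselect (nu (B n) = 0%E); last first.
  rewrite (_ : F n = set0); first exact: negligible_set0.
  by rewrite -subset0 => x [].
apply: (@negligibleS _ (borel X) R nu (B n)); first by move=> x [].
by apply/negligibleP => //; exact: open_measurable_borel.
Qed.

End wasserstein_symmetry.

(** * Continuity of the barycenter objective *)

Section barycenter_function.
Context (R : realType) (X : pmetricType R) (cptX : compact [set: X]).
Variable mu : Prob R X.

Definition mean_sqdist (y : X) : R := \int[mu]_x (mdist x y ^+ 2).

Lemma bounded_measurable_sqdistl y :
  @bounded_measurable _ (borel X) R (fun x => mdist x y ^+ 2).
Proof.
apply: continuous_bounded_measurable => // x; under eq_fun do rewrite metric_sym expr2.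
by apply: cvgM; exact: continuous_mdistr.
Qed.

Lemma mean_sqdistE y : (\int[mu]_x sqdist x y)%E = (mean_sqdist y)%:E.
Proof. by rewrite /sqdist integral_bounded//; exact: bounded_measurable_sqdistl. Qed.

(** Factoring a difference of squares gives the Lipschitz constant [2 * D]. Adding 1 keeps it
    positive even when [D] is 0, so that dividing by it reduces to the 1-Lipschitz case. *)
Lemma continuous_mean_sqdist : continuous mean_sqdist.
Proof.
have [D D0 DP] := mdist_bounded cptX.
have C0 : 0 < 2 * D + 1 by rewrite ltr_wpDl// mulr_ge0.
have lip y z : mean_sqdist y <= (2 * D + 1) * mdist y z + mean_sqdist z.
  have bz := bounded_measurable_sqdistl z.
  have bc := bounded_measurable_cst (borel X) ((2 * D + 1) * mdist y z).
  rewrite -[X in _ <= X + _](Rintegral_prob_cst mu).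
  rewrite -(RintegralD_bounded mu bc bz).
  apply: (le_Rintegral_bounded mu (bounded_measurable_sqdistl y)
    (bounded_measurableD bc bz)).
  move=> x; have := metric_triangle x z y; rewrite (metric_sym z y).
  have := DP x y; have := DP x z; have := mdist_ge0 x y; have := mdist_ge0 x z.
  have := mdist_ge0 y z.
  move: (mdist x y) (mdist x z) (mdist y z) => u v w; nra.
have -> : mean_sqdist = (fun y => (2 * D + 1) * (mean_sqdist y / (2 * D + 1))).
  by apply/funext => y; rewrite mulrC divfK// gt_eqF.
move=> y; apply: cvgM; first exact: cvg_cst.
apply: lipschitz1_continuous => {}y z.
by rewrite ler_pdivrMr// mulrDl divfK ?gt_eqF// mulrC.
Qed.

End barycenter_function.

(** * The limit measure [B] and measures close to optimal *)

Section limit_measure.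
Context (R : realType) (X : pmetricType R) (cptX : compact [set: X]).
Context (m : Prob R X) (reg : regular_mms m).
Variables (a : X -> R) (ca : continuous a) (a_ge0 : forall y, 0 <= a y)
  (a0 : exists y, a y = 0).
Variables (T : borel X -> borel X) (mT : measurable_fun setT T)
  (NT : forall x, nearest a x (T x)) (B : Prob R X) (BE : forall A, B A = m (T @^-1` A)).

Let C0 := sqdist_to a m.

Let law_T : has_law m T B.
Proof. by split=> // A mA; rewrite BE. Qed.

Lemma Rintegral_limit_zero : \int[B]_y a y = 0.
Proof.
rewrite (Rintegral_law law_T (continuous_bounded_measurable cptX ca)).
rewrite (_ : (fun x => a (T x)) = fun=> 0) ?Rintegral_prob_cst//.
by apply/funext => x; have [] := NT x.
Qed.

Lemma sqdist_to_ge0 : 0 <= C0.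
Proof. by apply: Rintegral_ge0 => x _; exact: sqr_ge0. Qed.

Lemma sqdist_to_le_W2sq (nu : Prob R X) : \int[nu]_y a y = 0 -> (C0%:E <= W2sq m nu)%E.
Proof.
move=> nua; apply/ereal_infP => _ [gamma gc <-].
have [gm gnu] := coupling_has_law gc; have [msnd _] := gnu.
rewrite costE// lee_fin (Rintegral_sqdist_gap cptX a0 gm msnd) lerDl.
apply: (Rintegral_gap_ge0 cptX ca a_ge0 a0 gm msnd).
by rewrite -nua (Rintegral_law gnu (continuous_bounded_measurable cptX ca)).
Qed.

(** The graph of [T] couples [m] with [B] at exactly the lower bound of [sqdist_to_le_W2sq]. *)
Lemma W2sq_limit : W2sq m B = C0%:E.
Proof.
apply/eqP; rewrite eq_le sqdist_to_le_W2sq ?andbT; last exact: Rintegral_limit_zero.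
have mid : measurable_fun setT (id : borel X -> borel X) by exact: measurable_id.
have [gamma gE] := prob_pushforward m (measurable_borel_pair cptX mid mT).
have law_gamma : has_law m (fun x : borel X => (x, T x) : borel (X * X)%type) gamma.
  by split=> [|A mA]; [exact: measurable_borel_pair|rewrite gE].
apply: ereal_inf_lbound; exists gamma.
  by split=> A mA; rewrite /pushforward gE// BE.
rewrite costE// (Rintegral_law law_gamma (bounded_measurable_sqdist cptX)).
congr EFin; congr Rintegral; apply/funext => x /=.
by rewrite (mdist_nearest (NT x)).
Qed.

(** Since [stability] bounds integrals from above, it is applied to [phi] and to [- phi]. *)
Lemma near_optimal_integral (phi : X -> R) (e : R) : continuous phi -> 0 < e ->
  exists2 dl, 0 < dl & forall nu : Prob R X, \int[nu]_y a y <= dl ->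
    (W2sq m nu <= C0%:E)%E -> `|\int[nu]_y phi y - \int[B]_y phi y| <= e.
Proof.
move=> cphi e0; have sel := regular_selections_ae_eq cptX ca a_ge0 a0 reg.
have cnphi : continuous (fun y => - phi y) by move=> y; apply: cvgN; exact: cphi.
have [d1 d10 H1] := stability cptX ca a_ge0 a0 sel mT NT cphi e0.
have [d2 d20 H2] := stability cptX ca a_ge0 a0 sel mT NT cnphi e0.
exists (Num.min d1 d2); first by rewrite lt_min d10.
move=> nu; rewrite le_min => /andP[ad1 ad2] Wnu.
(* A coupling of cost below [C0 + Num.min d1 d2] has mean gap below both thresholds. *)
have /ereal_inf_lt[_ [gamma gc <-]] : (W2sq m nu < (C0 + Num.min d1 d2)%:E)%E.
  by rewrite (le_lt_trans Wnu)// lte_fin ltrDl lt_min d10.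
have [gm gnu] := coupling_has_law gc; have [msnd _] := gnu.
rewrite costE// lte_fin (Rintegral_sqdist_gap cptX a0 gm msnd) ltrD2l lt_min.
move=> /andP[/ltW gd1 /ltW gd2].
have ba := continuous_bounded_measurable cptX ca.
have bphi := continuous_bounded_measurable cptX cphi.
have bphiT := bounded_measurable_comp mT bphi.
rewrite (Rintegral_law gnu ba) in ad1 ad2.
have := H1 _ _ _ _ _ gm msnd ad1 gd1; have := H2 _ _ _ _ _ gm msnd ad2 gd2.
rewrite (Rintegral_law gnu bphi) (Rintegral_law law_T bphi).
have RintegralN d (Om : measurableType d) (P : probability Om R) (g : Om -> R) :
    bounded_measurable g -> \int[P]_w (- g w) = - \int[P]_w g w.
  move=> bg; rewrite -mulN1r -(RintegralZ_bounded P _ bg).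
  by congr Rintegral; apply/funext => w; rewrite mulN1r.
rewrite (RintegralN _ _ _ _ (bounded_measurable_comp msnd bphi)).
rewrite (RintegralN _ _ _ _ bphiT).
rewrite ler_norml; lra.
Qed.

Lemma supp_limit_sub : supp B `<=` [set y | a y = 0].
Proof.
have cK := closed_zeros ca a_ge0.
move=> x Bx; apply: contrapT => ax; have := Bx (~` [set y | a y = 0]).
rewrite BE (_ : _ @^-1` _ = set0) ?measure0 ?ltxx; last first.
  by rewrite -subset0 => y; apply; have [] := NT y.
by move=> h; have : false by apply: h; split=> //; rewrite openC.
Qed.

(** As [x] lies in [K], a point [y] within [r / 2] of [x] has its nearest points within [r / 2] of
    itself, so [T] maps that ball into [U]. *)
Lemma supp_limit_sup : supp m `&` [set y | a y = 0] `<=` supp B.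
Proof.
move=> x [mx ax] U xU; have /nbhs_mdist[r r0 rU] := open_nbhs_nbhs xU.
pose V := [set y | mdist x y < r / 2].
have oV : open V.
  have /continuousP := @continuous_mdistr R X x.
  by move=> /(_ [set s | s < r / 2]); apply; exact: open_lt.
have mV : (0 < m V)%E.
  by apply: mx; split=> //; rewrite /V/= mdistxx divr_gt0.
rewrite BE (lt_le_trans mV)//; apply: le_measure.
- by rewrite inE; exact: open_measurable_borel.
- rewrite inE -[X in measurable X]setTI; apply: mT => //.
  by apply: open_measurable_borel; case: xU.
- move=> y Vy /=; apply: rU; have := metric_triangle x y (T y).
  have := infdist_le y ax; rewrite -(mdist_nearest (NT y)) (metric_sym y x).
  by move: Vy; rewrite /V/=; lra.
Qed.

End limit_measure.

(** * Comparison of [mu_ eps] with [B]: convergence, supports and minimality *)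

Theorem theorem2p2 (R : realType) (X : pmetricType R)
    (cptX : compact [set: X]) (m : Prob R X) (reg : regular_mms m)
    (mu : Prob R X) (mu_ : R -> Prob R X)
    (mu_min : forall eps : R, 0 < eps ->
       argmin [set: Prob R X] (F_eps m mu eps) (mu_ eps)) :
  exists B : Prob R X,
    [/\ mu_ eps @[eps --> 0^'+] --> B,
        forall B' : Prob R X, mu_ eps @[eps --> 0^'+] --> B' -> borel_eq B' B,
        supp m `&` barycenters mu `<=` supp B,
        supp B `<=` barycenters mu &
        argmin [set nu : Prob R X | supp nu `<=` barycenters mu]
               (fun nu => W2 nu m)
        = [set nu : Prob R X | borel_eq nu B]].
Proof.
have cf := @continuous_mean_sqdist R X cptX mu.
have [y0 _ y0min] := compact_argmin cf cptX (ex_intro _ point I).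
pose a y := mean_sqdist mu y - mean_sqdist mu y0.
have ca : continuous a by move=> y; apply: cvgB; [exact: cf|exact: cvg_cst].
have a_ge0 y : 0 <= a y by rewrite subr_ge0 y0min.
have a0 : exists y, a y = 0 by exists y0; rewrite /a subrr.
have KE : barycenters mu = [set y | a y = 0].
  apply/seteqP; split=> y; rewrite /barycenters /argmin/=.
    move=> [_ /(_ y0 I)]; rewrite !mean_sqdistE// lee_fin => fy.
    by apply/eqP; rewrite eq_le a_ge0 andbT subr_le0.
  move=> /eqP; rewrite subr_eq0 => /eqP fy; split=> // z _.
  by rewrite !mean_sqdistE// lee_fin fy y0min.
(* Any measurable selection serves as [T], so the function to minimize is taken to be zero. *)
have c0 : continuous (fun _ : X => 0 : R) by move=> y; exact: cvg_cst.
have [T [mT NT _]] := measurable_selection_argmin cptX (nearest_corr cptX ca a_ge0 a0) c0.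
have [B BE] := prob_pushforward m mT.
have aB := Rintegral_limit_zero cptX ca mT NT BE.
have WB := W2sq_limit cptX ca a_ge0 a0 mT NT BE.
have lowW := sqdist_to_le_W2sq cptX m ca a_ge0 a0.
have stab := near_optimal_integral cptX reg ca a_ge0 a0 mT NT BE.
set C0 := sqdist_to a m in WB lowW stab.
have C0_ge0 : 0 <= C0 by exact: sqdist_to_ge0.
have ba := continuous_bounded_measurable cptX ca.
have FE nu eps : F_eps m mu eps nu =
    ((\int[nu]_y a y + mean_sqdist mu y0)%:E + eps%:E * W2sq m nu)%E.
  rewrite /F_eps; congr (_ + _)%E.
  have -> : (fun y => \int[mu]_x sqdist y x)%E = (fun y => (mean_sqdist mu y)%:E).
    apply/funext => y; rewrite -mean_sqdistE//.
    by congr integral; apply/funext => x; rewrite /sqdist metric_sym.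
  have bf := continuous_bounded_measurable cptX cf.
  rewrite integral_bounded//; congr EFin.
  rewrite -[X in _ + X](Rintegral_prob_cst nu).
  have bc := bounded_measurable_cst (borel X) (mean_sqdist mu y0).
  rewrite -(RintegralD_bounded nu ba bc).
  by congr Rintegral; apply/funext => y; rewrite /a subrK.
have muE eps : 0 < eps -> \int[mu_ eps]_y a y <= eps * C0 /\
    (W2sq m (mu_ eps) <= C0%:E)%E.
  (* Tested against [B], which has mean excess 0 and [W2sq] equal to [C0], minimality bounds the
     mean excess plus [eps * W2sq] by [eps * C0]; both terms are nonnegative. *)
  move=> eps0; have [_ /(_ B I)] := mu_min eps eps0.
  have am : 0 <= \int[mu_ eps]_y a y by exact: Rintegral_ge0.
  have := W2sq_ge0 cptX m (mu_ eps).
  rewrite !FE aB WB; case: (W2sq m (mu_ eps)) => [r||]//.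
    rewrite -!EFinM -!EFinD !lee_fin => r0 le_r.
    have er : eps * r <= eps * C0 by lra.
    split; last by rewrite -(ler_pM2l eps0).
    have := mulr_ge0 (ltW eps0) r0; lra.
  (* An infinite [W2sq] would make [F_eps] infinite, against minimality. *)
  by move=> _; rewrite mulry gtr0_sg// mul1e addey// leye_eq.
have Bcvg : mu_ eps @[eps --> 0^'+] --> B.
  apply/cvg_ProbP => phi; apply/cvgrPdist_le => e e0.
  have [dl dl0 H] := stab phi e (@cts_fun _ _ phi) e0.
  suff : \forall eps \near 0^'+, `|\int[B]_y phi y - \int[mu_ eps]_y phi y| <= e by [].
  near=> eps; have eps0 : 0 < eps by near: eps; exact: nbhs_right_gt.
  have [aeps Weps] := muE eps eps0.
  rewrite distrC; apply: H => //; apply: le_trans aeps _.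
  (* [C0 + 1] is a positive denominator even when [C0] is 0. *)
  have : eps < dl / (C0 + 1).
    by near: eps; apply: nbhs_right_lt; rewrite divr_gt0// ltr_wpDl.
  rewrite ltr_pdivlMr ?ltr_wpDl//.
  have := ltW eps0; lra.
have uniq (nu : Prob R X) : (forall phi : X -> R, continuous phi ->
    \int[nu]_y phi y = \int[B]_y phi y) -> borel_eq nu B.
  exact: borel_eq_continuous.
exists B; split => //.
- move=> B' B'cvg; apply: uniq => phi cphi.
  have /cvg_ProbP/(_ (mkcts cphi)) h1 := Bcvg.
  have /cvg_ProbP/(_ (mkcts cphi)) h2 := B'cvg.
  exact: cvg_unique h2 h1.
- by rewrite KE; exact: (supp_limit_sup mT NT BE).
- by rewrite KE; exact: (supp_limit_sub ca a_ge0 NT BE).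
have sB : supp B `<=` barycenters mu.
  by rewrite KE; exact: (supp_limit_sub ca a_ge0 NT BE).
have anu (nu : Prob R X) : supp nu `<=` barycenters mu -> \int[nu]_y a y = 0.
  rewrite KE => snu; have cK := closed_zeros ca a_ge0.
  apply: (@Rintegral_eq0 _ (borel X) R nu [set y | a y = 0]) => //.
  - exact: closed_measurable_borel.
  - exact: supp_sub_null.
  - by have [] := ba.
apply/seteqP; split=> nu /=.
  (* A minimizer has mean excess zero and [W2sq] at most [C0], so [stab] applies for every [e]. *)
  move=> [snu numin]; apply: uniq => phi cphi; apply/eqP; rewrite -subr_eq0 -normr_le0.
  apply/ler_addgt0Pl => e e0; rewrite addr0.
  have [dl dl0 H] := stab phi e cphi e0; apply: H.
    by rewrite anu// ltW.
  rewrite -WB (W2sq_sym cptX m nu) (W2sq_sym cptX m B).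
  by rewrite -lee_sqrt ?W2sq_ge0//; exact: numin.
(* Conversely, measures equal on Borel sets share their support and their couplings, hence their
   distance to [m]. *)
move=> nuB; have snu : supp nu = supp B.
  apply/seteqP; split=> x h U xU; have mU : measurable (U : set (borel X)) by
    apply: open_measurable_borel; case: xU.
    by rewrite -nuB//; exact: h.
  by rewrite nuB//; exact: h.
have cE : coupling nu m = coupling B m.
  apply/seteqP; split=> gamma [g1 g2]; split=> // A mA.
    by rewrite g1// nuB.
  by rewrite g1// nuB.
split=> [|nu' snu']; first by rewrite /= snu.
rewrite /W2 lee_sqrt ?W2sq_ge0// {1}/W2sq cE -/(W2sq B m) W2sq_sym// WB.
by rewrite W2sq_sym//; apply: lowW; exact: anu.
Unshelve. all: by end_near. Qed.
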